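(* For every $2$-polygraph $\Sigma$, the natural system $h_2(\Sigma)$ of homological $2$-syzygies of $\Sigma$ and the natural system $\Pi(\Sigma)$ of identities among relations of $\Sigma$ are isomorphic (as natural systems on $\overline{\Sigma}$).
   Context: A $2$-polygraph $\Sigma$ consists of a set $\Sigma_0$, a graph $\Sigma_1$ over $\Sigma_0$ with free category $\Sigma_1^*$, and a set $\Sigma_2$ of $2$-cells $\varphi:u\Rightarrow v$ between parallel $1$-cells of $\Sigma_1^*$. $\Sigma^{\top}$ is the free $(2,1)$-category it generates ($1$-cells those of $\Sigma_1^*$; $2$-cells freely generated by $\Sigma_2$ and formal inverses $f^-$). $f\star_1 g$ is vertical composition of $2$-cells (first $f$, then $g$), and concatenation is $0$-composition. $\overline{\Sigma}=\Sigma_1^*/\Sigma_2$ is the presented category; $\overline{u}$ is the image of a $1$-cell $u$, and for a $2$-cell $f:u\Rightarrow v$, $\overline{f}=\overline{u}=\overline{v}$. Write $\mathbf{C}=\overline{\Sigma}$. The category of factorisations $F\mathbf{C}$ has the $1$-cells of $\mathbf{C}$ as objects and as morphisms $w\to w'$ the pairs $(u,v)$ of $1$-cells with $uwv=w'$, composed by $(u,v)(u',v')=(u'u,vv')$. A natural system on $\mathbf{C}$ is a functor $D:F\mathbf{C}\to\mathbf{Ab}$, with values $D_w$; $uav$ denotes $D(u,v)(a)$. For $k=1,2$, $F_{\mathbf{C}}[\Sigma_k]$ is the natural system with $F_{\mathbf{C}}[\Sigma_k]_w$ the free abelian group on the symbols $u[\varphi]v$ with $\varphi\in\Sigma_k$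 and $u,v$ $1$-cells of $\mathbf{C}$ such that $u\overline{\varphi}v=w$. For a $1$-cell $u$ of $\Sigma_1^*$, $[u]\in F_{\mathbf{C}}[\Sigma_1]_{\overline{u}}$ is defined by extending $x\mapsto[x]$ by $[1_x]=0$ and $[uv]=[u]\overline{v}+\overline{u}[v]$. The morphism $\delta_2:F_{\mathbf{C}}[\Sigma_2]\to F_{\mathbf{C}}[\Sigma_1]$ is given by $\delta_2[\alpha]=[s(\alpha)]-[t(\alpha)]$ for $\alpha\in\Sigma_2$. The natural system of homological $2$-syzygies is $h_2(\Sigma)=\ker\delta_2$. A $2$-cell of $\Sigma^{\top}$ is closed when its source and target coincide. The natural system $\Pi(\Sigma)$ on $\mathbf{C}$: for a $1$-cell $u$ of $\mathbf{C}$, $\Pi(\Sigma)_u$ is the abelian group generated by elements $\lfloor f\rfloor$, one for each closed $2$-cell $f:v\Rightarrow v$ of $\Sigma^{\top}$ with $\overline{v}=u$, subject to $\lfloor f\star_1 g\rfloor=\lfloor f\rfloor+\lfloor g\rfloor$ for $f,g:v\Rightarrow v$ with $\overline{v}=u$, and $\lfloor f\star_1 g\rfloor=\lfloor g\star_1 f\rfloor$ for $f:v\Rightarrow w$, $g:w\Rightarrow v$ with $\overline{v}=\overline{w}=u$. A morphism $(a,b)$ of $F\mathbf{C}$ acts by $\lfloor f\rfloor\mapsto\lfloor\widehat{a}f\widehat{b}\rfloor$, where $\widehat{a},\widehat{b}$ are any $1$-cells of $\Sigma_1^*$ representing $a,b$ (this is independent of the choice). *)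

(* Defs.v *)
From HB Require Import structures.
From Stdlib Require Import RelationClasses.
From mathcomp Require Import all_boot all_algebra.
From mathcomp Require Import generic_quotient ring_quotient boolp.
From mathcomp Require Import freeg.

Set Implicit Arguments.
Unset Strict Implicit.
Unset Printing Implicit Defensive.

Import GRing.Theory.
Local Open Scope ring_scope.
Local Open Scope quotient_scope.

(** * Quotient of a type by a Prop-valued equivalence relation *)

Section ClassicalQuotient.
Variables (T : Type) (R : T -> T -> Prop) (eR : Equivalence R).

Definition crel : rel {classic T} := fun a b => `[< R a b >].

Lemma crel_equiv : equiv_class_of crel.
Proof.
split.
- by move=> a; apply/asboolP; apply: (@Equivalence_Reflexive _ _ eR).
- move=> a b; apply/asboolP/asboolP; exact: (@Equivalence_Symmetric _ _ eR).
- move=> b a c /asboolP ab /asboolP bc; apply/asboolP.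
  exact: (@Equivalence_Transitive _ _ eR) ab bc.
Qed.

Definition crelE : equiv_rel {classic T} := EquivRelPack crel_equiv.

Definition cquot : Type := {eq_quot crelE}.
Definition cpi (a : T) : cquot := \pi_({eq_quot crelE}) (a : {classic T}).
Definition crepr (q : cquot) : T := repr (q : {eq_quot crelE}).

Lemma creprK q : cpi (crepr q) = q.
Proof. exact: reprK. Qed.

Lemma cpiP a b : cpi a = cpi b <-> R a b.
Proof. by split=> [/eqmodP/asboolP|ab]; last apply/eqmodP/asboolP. Qed.

Lemma crepr_pi a : R (crepr (cpi a)) a.
Proof. by apply/cpiP; rewrite creprK. Qed.

End ClassicalQuotient.
Arguments cpi {T R} eR a.
Arguments crepr {T R eR} q.

(** * Abelian groups: free ones, presentations, kernels *)

Definition freeab (G : Type) : zmodType := {freeg {classic G} / int}.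
Definition fgen (G : Type) (g : G) : freeab G := << (g : {classic G}) >>.

Section FreeLift.
Variables (G : Type) (M : zmodType) (f : G -> M).

Definition freelift_fun (D : freeab G) : M :=
  fglift (f : {classic G} -> (zmodule M)) D.

Lemma freelift_is_zmod_morphism : zmod_morphism freelift_fun.
Proof. exact: (@lift_is_additive _ _ (zmodule M)). Qed.

HB.instance Definition _ :=
  GRing.isZmodMorphism.Build (freeab G) M freelift_fun freelift_is_zmod_morphism.

Definition freelift : {additive freeab G -> M} := freelift_fun.

Lemma freeliftE g : freelift (fgen g) = f g.
Proof.
by rewrite /freelift /= /freelift_fun liftU scale1r.
Qed.
End FreeLift.

Lemma freeab_ext (G : Type) (M : zmodType) (f h : {additive freeab G -> M}) :
  (forall g, f (fgen g) = h (fgen g)) -> f =1 h.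
Proof.
move=> fh D; rewrite -(freeg_sumE D) !raddf_sum; apply: eq_bigr => g _.
have -> : << coeff g D *g g >> = fgen g *~ coeff g D.
  by rewrite /fgen freegU_mulz; congr << _ *g _ >>; rewrite intz.
by rewrite !raddfMz fh.
Qed.

Section Presentation.
Variables (V : zmodType) (R : V -> Prop).

Definition subgen : {pred V} := fun x =>
  `[< forall S : V -> Prop, S 0 -> (forall y z, S y -> S z -> S (y - z)) ->
      (forall y, R y -> S y) -> S x >].

Lemma subgen_closed : zmod_closed subgen.
Proof.
split=> [|x y /asboolP Sx /asboolP Sy]; apply/asboolP => S S0 SB SR //.
exact: (SB _ _ (Sx S S0 SB SR) (Sy S S0 SB SR)).
Qed.

HB.instance Definition _ := GRing.isZmodClosed.Build V subgen subgen_closed.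

Definition abquot : zmodType := Quotient.quot subgen.
Definition abpi_fun (x : V) : abquot := \pi_(Quotient.quot subgen) x.

Lemma abpi_is_zmod_morphism : zmod_morphism abpi_fun.
Proof. by move=> x y; rewrite /abpi_fun !piE. Qed.

HB.instance Definition _ :=
  GRing.isZmodMorphism.Build V abquot abpi_fun abpi_is_zmod_morphism.

Definition abpi : {additive V -> abquot} := abpi_fun.

Lemma abpi_rel x : R x -> abpi x = 0.
Proof.
move=> Rx; rewrite -(raddf0 abpi); apply/eqP.
rewrite -Quotient.idealrBE subr0; by apply/asboolP => S _ _; apply.
Qed.

Lemma abpi_surj (q : abquot) : exists x, q = abpi x.
Proof. by exists (repr q); rewrite /abpi /= /abpi_fun reprK. Qed.

Variables (M : zmodType) (f : {additive V -> M}).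
Hypothesis fR : forall x, R x -> f x = 0.

Definition ablift_fun (q : abquot) : M := f (repr q).

Lemma ablift_subproof x y : abpi x = abpi y -> f x = f y.
Proof.
move/eqP; rewrite -Quotient.idealrBE => /asboolP /(_ (fun z => f z = 0)) fxy.
apply/eqP; rewrite -subr_eq0 -raddfB; apply/eqP/fxy => //; first exact: raddf0.
by move=> u v fu fv; rewrite raddfB fu fv subr0.
Qed.

Lemma ablift_funE x : ablift_fun (abpi x) = f x.
Proof. by apply: ablift_subproof; rewrite {1}/abpi /= /abpi_fun reprK. Qed.

Lemma ablift_is_zmod_morphism : zmod_morphism ablift_fun.
Proof.
move=> p q; have [[x ->] [y ->]] := (abpi_surj p, abpi_surj q).
by rewrite -raddfB !ablift_funE raddfB.
Qed.

HB.instance Definition _ :=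
  GRing.isZmodMorphism.Build abquot M ablift_fun ablift_is_zmod_morphism.

Definition ablift : {additive abquot -> M} := ablift_fun.

Lemma abliftE x : ablift (abpi x) = f x.
Proof. exact: ablift_funE. Qed.

End Presentation.

Section Kernel.
Variables (V W : zmodType) (f : {additive V -> W}).

Definition kerpred : {pred V} := fun x => f x == 0.

Lemma kerpred_closed : zmod_closed kerpred.
Proof.
split=> [|x y]; rewrite /kerpred !unfold_in ?raddf0 //.
by move=> /eqP fx /eqP fy; rewrite raddfB fx fy subr0.
Qed.

HB.instance Definition _ := GRing.isZmodClosed.Build V kerpred kerpred_closed.

Record kerab := Ker { kerval : V; kervalP : kerval \in kerpred }.
HB.instance Definition _ := [isSub for kerval].
HB.instance Definition _ := [Choice of kerab by <:].
HB.instance Definition _ := [SubChoice_isSubZmodule of kerab by <:].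
End Kernel.

(** * Categories, functors to abelian groups *)

(* Composition is written in diagrammatic order. *)
Record category := Category {
  obj :> Type;
  hom : obj -> obj -> Type;
  idm : forall x, hom x x;
  comp : forall x y z, hom x y -> hom y z -> hom x z;
  comp1m : forall x y (f : hom x y), comp (idm x) f = f;
  compm1 : forall x y (f : hom x y), comp f (idm y) = f;
  compA : forall x y z t (f : hom x y) (g : hom y z) (h : hom z t),
    comp f (comp g h) = comp (comp f g) h
}.
Arguments hom {_} _ _.
Arguments idm {_} x.
Arguments comp {_ x y z} _ _.

Record abfunctor (K : category) := AbFunctor {
  afob :> K -> zmodType;
  afact : forall w w' : K, hom w w' -> {additive afob w -> afob w'};
  afact1 : forall w a, afact (idm w) a = a;
  afactM : forall w w' w'' (m : hom w w') (m' : hom w' w'') a,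
    afact (comp m m') a = afact m' (afact m a)
}.
Arguments afact {K} _ {w w'} _.

Record nattrans (K : category) (D E : abfunctor K) := NatTrans {
  ntcomp :> forall w, {additive D w -> E w};
  ntnat : forall w w' (m : hom w w') a,
    ntcomp w' (afact D m a) = afact E m (ntcomp w a)
}.

Definition natiso (K : category) (D E : abfunctor K) : Prop :=
  exists (f : nattrans D E) (g : nattrans E D),
    (forall w, cancel (f w) (g w)) /\ (forall w, cancel (g w) (f w)).

Section KernelFunctor.
Variables (K : category) (D E : abfunctor K) (f : nattrans D E).

Section Act.
Variables (w w' : K) (m : hom w w').

Lemma keract_subproof (a : kerab (f w)) :
  afact D m (val a) \in kerpred (f w').
Proof.
by case: a => a /=; rewrite !unfold_in ntnat => /eqP ->; rewrite raddf0.
Qed.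

Definition keract_fun (a : kerab (f w)) : kerab (f w') := Ker (keract_subproof a).

Lemma keract_is_zmod_morphism : zmod_morphism keract_fun.
Proof. by move=> a b; apply: val_inj; rewrite /= !raddfB. Qed.

HB.instance Definition _ := GRing.isZmodMorphism.Build (kerab (f w)) (kerab (f w'))
  keract_fun keract_is_zmod_morphism.
End Act.

Definition kerfunctor : abfunctor K.
Proof.
refine (@AbFunctor K (fun w => kerab (f w) : zmodType)
  (fun w w' m => keract_fun m : {additive _ -> _}) _ _).
- by move=> w a; apply: val_inj; rewrite /= afact1.
- by move=> w w' w'' m m' a; apply: val_inj; rewrite /= afactM.
Defined.
End KernelFunctor.

(** * Factorisations and natural systems *)

Section Factorisations.
Variable C : category.

Record fobj := FObj { fsrc : C; ftgt : C; fcell : hom fsrc ftgt }.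

Record fhom (w w' : fobj) := FHom {
  fleft : hom (fsrc w') (fsrc w);
  fright : hom (ftgt w) (ftgt w');
  fhomE : comp (comp fleft (fcell w)) fright = fcell w'
}.

Lemma fhom_ext w w' (m n : fhom w w') :
  fleft m = fleft n -> fright m = fright n -> m = n.
Proof.
by case: m n => [a b e] [a' b' e'] /= ? ?; subst; congr FHom; exact: Prop_irrelevance.
Qed.

Lemma fidE (w : fobj) : comp (comp (idm _) (fcell w)) (idm _) = fcell w.
Proof. by rewrite compm1 comp1m. Qed.

Definition fid w : fhom w w := FHom (fidE w).

Lemma fcompE w w' w'' (m : fhom w w') (m' : fhom w' w'') :
  comp (comp (comp (fleft m') (fleft m)) (fcell w)) (comp (fright m) (fright m'))
  = fcell w''.
Proof. by rewrite -(fhomE m') -(fhomE m) !compA. Qed.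

Definition fcomp w w' w'' (m : fhom w w') (m' : fhom w' w'') : fhom w w'' :=
  FHom (fcompE m m').

Definition factcat : category.
Proof.
refine (@Category fobj fhom fid fcomp _ _ _).
- by move=> w w' m; apply: fhom_ext; rewrite /= ?compm1 ?comp1m.
- by move=> w w' m; apply: fhom_ext; rewrite /= ?compm1 ?comp1m.
- by move=> w0 w1 w2 w3 m n p; apply: fhom_ext; rewrite /= ?compA.
Defined.

Definition natsys := abfunctor factcat.

(* The free natural system on a family of 1-cells [c i] of C.  A symbol
   u[i]v with u (c i) v = w is the same thing as a morphism (u, v) from
   [c i] to w in the category of factorisations. *)
Section Free.
Variables (I : Type) (c : I -> fobj).

Definition fsymb (w : fobj) : Type := {i : I & fhom (c i) w}.

Definition fsymb_act w w' (m : fhom w w') (s : fsymb w) : fsymb w' :=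
  existT _ (projT1 s) (fcomp (projT2 s) m).

Definition freens : natsys.
Proof.
refine (@AbFunctor factcat (fun w => freeab (fsymb w))
  (fun w w' m => freelift (fun s => fgen (fsymb_act m s))) _ _).
- move=> w; apply: (freeab_ext (h := idfun)) => -[i n]; rewrite freeliftE /=.
  by congr (fgen (existT _ _ _)); apply: (@compm1 factcat).
- move=> w w' w'' m m'.
  set f := freelift _; set h := freelift _; set g := freelift _.
  apply: (freeab_ext (f := f) (h := h \o g)) => -[i n].
  rewrite /= !freeliftE /fsymb_act /=.
  by congr (fgen (existT _ _ _)); rewrite [LHS](@compA factcat).
Defined.

Definition fsym (i : I) : freens (c i) := fgen (existT _ i (fid (c i))).

Variables (D : natsys) (d : forall i, D (c i)).

(* The morphism of natural systems sending u[i]v to u (d i) v. *)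
Definition freens_lift : nattrans freens D.
Proof.
refine (@NatTrans factcat freens D (fun w =>
  freelift (fun s : fsymb w => afact D (projT2 s : @hom factcat _ _) (d (projT1 s)))) _).
move=> w w' m.
set f := freelift _; set g := freelift _.
apply: (freeab_ext (f := f \o afact freens m) (h := afact D m \o g)) => -[i n].
by rewrite /= !freeliftE /= -afactM.
Defined.

Lemma freens_liftE i : freens_lift (c i) (fsym i) = d i.
Proof. by rewrite /= freeliftE /=; apply: (@afact1 _ D). Qed.

End Free.
End Factorisations.

Arguments fsym {C I c} i.

(** * Free categories on graphs and 2-polygraphs *)

Section Paths.
Variables (V : Type) (E : V -> V -> Type).

Inductive path : V -> V -> Type :=
| pnil x : path x x
| pcons x y z : E x y -> path y z -> path x z.

Fixpoint pcat x y z (u : path x y) : path y z -> path x z :=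
  match u in path x y return path y z -> path x z with
  | pnil _ => fun v => v
  | pcons _ _ _ e u => fun v => pcons e (pcat u v)
  end.

Definition pone x y (e : E x y) : path x y := pcons e (pnil y).

Lemma pcatu0 x y (u : path x y) : pcat u (pnil y) = u.
Proof. by elim: u => //= ? ? ? e u ->. Qed.

Lemma pcatA x y z t (u : path x y) (v : path y z) (w : path z t) :
  pcat u (pcat v w) = pcat (pcat u v) w.
Proof. by elim: u v => //= ? ? ? e u IH v; rewrite IH. Qed.
End Paths.
Arguments pnil {V E} x.

Record polygraph2 := Polygraph2 {
  cells0 : Type;
  cells1 : cells0 -> cells0 -> Type;
  cells2 : forall x y, path cells1 x y -> path cells1 x y -> Type
}.
Arguments cells1 {_} _ _.
Arguments cells2 {_ x y} _ _.

Section Polygraph.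
Variable S : polygraph2.
Local Notation path1 := (path (@cells1 S)).

(** ** The presented category *)

Inductive pcong : forall x y, path1 x y -> path1 x y -> Prop :=
| PC_cell x y (u v : path1 x y) : cells2 u v -> pcong u v
| PC_refl x y (u : path1 x y) : pcong u u
| PC_sym x y (u v : path1 x y) : pcong u v -> pcong v u
| PC_trans x y (u v w : path1 x y) : pcong u v -> pcong v w -> pcong u w
| PC_cat x y z (u u' : path1 x y) (v v' : path1 y z) :
    pcong u u' -> pcong v v' -> pcong (pcat u v) (pcat u' v').

Lemma pcong_equiv x y : Equivalence (@pcong x y).
Proof.
by split=> [u|u v|u v w]; [exact: PC_refl | exact: PC_sym | exact: PC_trans].
Qed.

Definition pcell x y : Type := cquot (pcong_equiv x y).
Definition pbar x y (u : path1 x y) : pcell x y := cpi (pcong_equiv x y) u.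

Definition pcomp x y z (a : pcell x y) (b : pcell y z) : pcell x z :=
  pbar (pcat (crepr a) (crepr b)).

Lemma pbar_cat x y z (u : path1 x y) (v : path1 y z) :
  pbar (pcat u v) = pcomp (pbar u) (pbar v).
Proof. by apply/esym/cpiP; apply: PC_cat; apply: crepr_pi. Qed.

Lemma pbar_surj x y (a : pcell x y) : exists u, a = pbar u.
Proof. by exists (crepr a); rewrite /pbar creprK. Qed.

Definition presented : category.
Proof.
refine (@Category (cells0 S) pcell (fun x => pbar (pnil x)) pcomp _ _ _).
- by move=> x y a; have [u ->] := pbar_surj a; rewrite -pbar_cat.
- by move=> x y a; have [u ->] := pbar_surj a; rewrite -pbar_cat pcatu0.
- move=> x y z t a b c; have [[u ->] [v ->]] := (pbar_surj a, pbar_surj b).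
  by have [w ->] := pbar_surj c; rewrite -!pbar_cat pcatA.
Defined.

(* The 1-cell [pbar u] as an object of the category of factorisations. *)
Definition bobj x y (u : path1 x y) : fobj presented :=
  @FObj presented x y (pbar u).

(** ** Homological 2-syzygies *)

Definition sigma1 : Type := {x & {y & @cells1 S x y}}.
Definition bar1 (i : sigma1) : fobj presented := bobj (pone (projT2 (projT2 i))).
Definition FC1 : natsys presented := freens bar1.

Definition symb1 x y (e : cells1 x y) : FC1 (bobj (pone e)) :=
  fsym (existT _ x (existT _ y e) : sigma1).

Record sigma2 := Sigma2 {
  s2x : cells0 S;
  s2y : cells0 S;
  src2 : path1 s2x s2y;
  tgt2 : path1 s2x s2y;
  cell2 : cells2 src2 tgt2
}.
Definition bar2 (i : sigma2) : fobj presented := bobj (src2 i).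
Definition FC2 : natsys presented := freens bar2.

Lemma rightm_subproof x y z (u : path1 x y) (v : path1 y z) :
  @comp presented _ _ _ (comp (idm (x : presented)) (pbar u)) (pbar v)
  = pbar (pcat u v).
Proof. by rewrite comp1m [RHS]pbar_cat. Qed.

Definition rightm x y z (u : path1 x y) (v : path1 y z) :
    @hom (factcat presented) (bobj u) (bobj (pcat u v)) :=
  @FHom presented (bobj u) (bobj (pcat u v)) (idm (x : presented)) (pbar v)
    (rightm_subproof u v).

Lemma leftm_subproof x y z (u : path1 x y) (v : path1 y z) :
  @comp presented _ _ _ (@comp presented _ _ _ (pbar u) (pbar v))
    (idm (z : presented)) = pbar (pcat u v).
Proof. by rewrite compm1 [RHS]pbar_cat. Qed.

Definition leftm x y z (u : path1 x y) (v : path1 y z) :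
    @hom (factcat presented) (bobj v) (bobj (pcat u v)) :=
  @FHom presented (bobj v) (bobj (pcat u v)) (pbar u) (idm (z : presented))
    (leftm_subproof u v).

(* [e u] = [e] ubar + ebar [u]; the rule for an arbitrary concatenation is
   [bracket_cat] below. *)
Fixpoint bracket x y (u : path1 x y) : FC1 (bobj u) :=
  match u in path _ x y return FC1 (bobj u) with
  | pnil _ => 0
  | pcons _ _ _ e u =>
      afact FC1 (rightm (pone e) u) (symb1 e) + afact FC1 (leftm (pone e) u) (bracket u)
  end.

Lemma bracket_cat x y z (u : path1 x y) (v : path1 y z) :
  bracket (pcat u v) =
  afact FC1 (rightm u v) (bracket u) + afact FC1 (leftm u v) (bracket v).
Proof.
elim: u v => [x' v|x' y' z' e u IH v].
  rewrite /= raddf0 add0r.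
  have -> : leftm (pnil x') v = idm _ by exact: fhom_ext.
  by rewrite [RHS](@afact1 _ FC1).
rewrite [bracket (pcat _ _)]/= IH [bracket (pcons e u)]/= !raddfD addrA.
have RR : rightm (pone e) (pcat u v) = comp (rightm (pone e) u) (rightm (pcons e u) v).
  by apply: fhom_ext; rewrite /= -pbar_cat.
have LR : comp (rightm u v) (leftm (pone e) (pcat u v))
        = comp (leftm (pone e) u) (rightm (pcons e u) v).
  by apply: fhom_ext; rewrite /= -!pbar_cat ?pcatu0.
have LL : leftm (pcons e u) v = comp (leftm u v) (leftm (pone e) (pcat u v)).
  by apply: fhom_ext; rewrite /= -!pbar_cat ?pcatu0.
congr (_ + _ + _).
- by rewrite RR (@afactM _ FC1).
- rewrite -[LHS](@afactM _ FC1) LR; exact: (@afactM _ FC1).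
- by rewrite LL; apply/esym/(@afactM _ FC1).
Qed.

(* Morphism (1, 1) of the category of factorisations between two equal 1-cells,
   used to compare the fibres over [pbar u] and [pbar v]. *)
Lemma coerm_subproof x y (u v : path1 x y) : pbar u = pbar v ->
  @comp presented _ _ _ (@comp presented _ _ _ (idm (x : presented)) (pbar u))
    (idm (y : presented)) = pbar v.
Proof. by rewrite compm1 comp1m. Qed.

Definition coerm x y (u v : path1 x y) (e : pbar u = pbar v) :
    @hom (factcat presented) (bobj u) (bobj v) :=
  @FHom presented (bobj u) (bobj v) (idm (x : presented)) (idm (y : presented))
    (coerm_subproof e).

Lemma bar_tgt (i : sigma2) : pbar (tgt2 i) = pbar (src2 i).
Proof. by apply/cpiP/PC_sym/PC_cell; exact: cell2 i. Qed.

Definition delta2 : nattrans FC2 FC1 :=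
  freens_lift (c := bar2) (D := FC1) (fun i =>
    bracket (src2 i) - afact FC1 (coerm (bar_tgt i)) (bracket (tgt2 i))).

Lemma delta2E (i : sigma2) :
  delta2 (bar2 i) (fsym i) =
  bracket (src2 i) - afact FC1 (coerm (bar_tgt i)) (bracket (tgt2 i)).
Proof.
exact: (@freens_liftE _ _ bar2 FC1 (fun i =>
  bracket (src2 i) - afact FC1 (coerm (bar_tgt i)) (bracket (tgt2 i)))).
Qed.

Definition h2 : natsys presented := kerfunctor delta2.

(** ** The free (2,1)-category *)

Inductive term2 : forall x y, path1 x y -> path1 x y -> Type :=
| TGen x y (u v : path1 x y) : cells2 u v -> term2 u v
| TId x y (u : path1 x y) : term2 u u
| TInv x y (u v : path1 x y) : term2 u v -> term2 v u
| TV x y (u v w : path1 x y) : term2 u v -> term2 v w -> term2 u w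
| TH x y z (u u' : path1 x y) (v v' : path1 y z) :
    term2 u u' -> term2 v v' -> term2 (pcat u v) (pcat u' v').

(* The congruence generated by the axioms of (2,1)-categories.  It is
   heterogeneous because the associativity and unit axioms of the
   0-composition relate terms whose boundaries are equal only
   propositionally; see [teq_boundary]. *)
Inductive teq : forall x y (u v u' v' : path1 x y),
    term2 u v -> term2 u' v' -> Prop :=
| TE_refl x y (u v : path1 x y) (f : term2 u v) : teq f f
| TE_sym x y (u v u' v' : path1 x y) (f : term2 u v) (f' : term2 u' v') :
    teq f f' -> teq f' f
| TE_trans x y (u v u' v' u'' v'' : path1 x y)
    (f : term2 u v) (f' : term2 u' v') (f'' : term2 u'' v'') :
    teq f f' -> teq f' f'' -> teq f f''
| TE_Inv x y (u v u' v' : path1 x y) (f : term2 u v) (f' : term2 u' v') :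
    teq f f' -> teq (TInv f) (TInv f')
| TE_V x y (u v w u' v' w' : path1 x y)
    (f : term2 u v) (g : term2 v w) (f' : term2 u' v') (g' : term2 v' w') :
    teq f f' -> teq g g' -> teq (TV f g) (TV f' g')
| TE_H x y z (u v u' v' : path1 x y) (s t s' t' : path1 y z)
    (f : term2 u v) (g : term2 s t) (f' : term2 u' v') (g' : term2 s' t') :
    teq f f' -> teq g g' -> teq (TH f g) (TH f' g')
| TE_VA x y (u v w t : path1 x y)
    (f : term2 u v) (g : term2 v w) (h : term2 w t) :
    teq (TV f (TV g h)) (TV (TV f g) h)
| TE_V1l x y (u v : path1 x y) (f : term2 u v) : teq (TV (TId u) f) f
| TE_V1r x y (u v : path1 x y) (f : term2 u v) : teq (TV f (TId v)) f
| TE_VInvr x y (u v : path1 x y) (f : term2 u v) : teq (TV f (TInv f)) (TId u)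
| TE_VInvl x y (u v : path1 x y) (f : term2 u v) : teq (TV (TInv f) f) (TId v)
| TE_HA x y z t (u u' : path1 x y) (v v' : path1 y z) (w w' : path1 z t)
    (f : term2 u u') (g : term2 v v') (h : term2 w w') :
    teq (TH f (TH g h)) (TH (TH f g) h)
| TE_H1l x y (u v : path1 x y) (f : term2 u v) : teq (TH (TId (pnil x)) f) f
| TE_H1r x y (u v : path1 x y) (f : term2 u v) : teq (TH f (TId (pnil y))) f
| TE_HId x y z (u : path1 x y) (v : path1 y z) :
    teq (TH (TId u) (TId v)) (TId (pcat u v))
| TE_HV x y z (u u' u'' : path1 x y) (v v' v'' : path1 y z)
    (f : term2 u u') (f' : term2 u' u'') (g : term2 v v') (g' : term2 v' v'') :
    teq (TH (TV f f') (TV g g')) (TV (TH f g) (TH f' g')).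

Lemma teq_boundary x y (u v u' v' : path1 x y) (f : term2 u v) (f' : term2 u' v') :
  teq f f' -> u = u' /\ v = v'.
Proof.
elim=> *;
  repeat match goal with H : _ /\ _ |- _ => case: H => ? ?; subst end;
  by rewrite ?pcatA ?pcatu0.
Qed.

Lemma teq_equiv x y (u v : path1 x y) :
  Equivalence (fun f g : term2 u v => teq f g).
Proof.
by split=> [f|f g|f g h]; [exact: TE_refl | exact: TE_sym | exact: TE_trans].
Qed.

Definition tcell x y (u v : path1 x y) : Type := cquot (teq_equiv u v).
Definition tpi x y (u v : path1 x y) (f : term2 u v) : tcell u v :=
  cpi (teq_equiv u v) f.

Definition tid x y (u : path1 x y) : tcell u u := tpi (TId u).
Definition tinv x y (u v : path1 x y) (f : tcell u v) : tcell v u :=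
  tpi (TInv (crepr f)).
(* Vertical composition, [f] first, then [g]. *)
Definition tcomp1 x y (u v w : path1 x y) (f : tcell u v) (g : tcell v w) :
  tcell u w := tpi (TV (crepr f) (crepr g)).
Definition tcomp0 x y z (u u' : path1 x y) (v v' : path1 y z)
    (f : tcell u u') (g : tcell v v') : tcell (pcat u v) (pcat u' v') :=
  tpi (TH (crepr f) (crepr g)).
Definition twhisk x y z t (a : path1 x y) (u v : path1 y z) (b : path1 z t)
    (f : tcell u v) : tcell (pcat (pcat a u) b) (pcat (pcat a v) b) :=
  tcomp0 (tcomp0 (tid a) f) (tid b).

Lemma tpi_surj x y (u v : path1 x y) (f : tcell u v) : exists t, f = tpi t.
Proof. by exists (crepr f); rewrite /tpi creprK. Qed.

Lemma tpi_inv x y (u v : path1 x y) (f : term2 u v) :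
  tinv (tpi f) = tpi (TInv f).
Proof. by apply/cpiP/TE_Inv/(crepr_pi (teq_equiv u v)). Qed.

Lemma tpi_comp1 x y (u v w : path1 x y) (f : term2 u v) (g : term2 v w) :
  tcomp1 (tpi f) (tpi g) = tpi (TV f g).
Proof.
by apply/cpiP/TE_V; [exact: (crepr_pi (teq_equiv u v)) | exact: (crepr_pi (teq_equiv v w))].
Qed.

Lemma tpi_comp0 x y z (u u' : path1 x y) (v v' : path1 y z)
  (f : term2 u u') (g : term2 v v') : tcomp0 (tpi f) (tpi g) = tpi (TH f g).
Proof.
by apply/cpiP/TE_H; [exact: (crepr_pi (teq_equiv u u')) | exact: (crepr_pi (teq_equiv v v'))].
Qed.

Definition Twhisk x y z t (a : path1 x y) (u v : path1 y z) (b : path1 z t)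
    (f : term2 u v) : term2 (pcat (pcat a u) b) (pcat (pcat a v) b) :=
  TH (TH (TId a) f) (TId b).

Lemma tpi_whisk x y z t (a : path1 x y) (u v : path1 y z) (b : path1 z t)
  (f : term2 u v) : twhisk a b (tpi f) = tpi (Twhisk a b f).
Proof. by rewrite /twhisk /tid !tpi_comp0. Qed.

Lemma pcong_term2 x y (u v : path1 x y) : pcong u v <-> inhabited (term2 u v).
Proof.
split=> [|[f]].
- elim=> *; repeat match goal with H : inhabited _ |- _ => case: H => ? end;
    constructor.
  + exact: TGen.
  + exact: TId.
  + exact: TInv.
  + by apply: TV; eassumption.
  + exact: TH.
- elim: f => *.
  + exact: PC_cell.
  + exact: PC_refl.
  + exact: PC_sym.
  + by apply: PC_trans; eassumption.
  + exact: PC_cat.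
Qed.

(** ** Identities among relations *)

(* Closed 2-cells f : v => v with v representing w. *)
Record closed2 (w : fobj presented) := Closed2 {
  cl1 : path1 (fsrc w) (ftgt w);
  cl2 : tcell cl1 cl1;
  clE : pbar cl1 = fcell w
}.
Arguments Closed2 {w cl1} cl2 clE.

Inductive Pi_rel (w : fobj presented) : freeab (closed2 w) -> Prop :=
| PR_comp (v : path1 (fsrc w) (ftgt w)) (e : pbar v = fcell w) (f g : tcell v v) :
    Pi_rel (fgen (Closed2 (tcomp1 f g) e)
            - (fgen (Closed2 f e) + fgen (Closed2 g e)))
| PR_cycl (v v' : path1 (fsrc w) (ftgt w)) (e : pbar v = fcell w)
    (e' : pbar v' = fcell w) (f : tcell v v') (g : tcell v' v) :
    Pi_rel (fgen (Closed2 (tcomp1 f g) e) - fgen (Closed2 (tcomp1 g f) e')).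

Definition Pi_ab (w : fobj presented) : zmodType := abquot (@Pi_rel w).
Definition Pi_gen (w : fobj presented) (f : closed2 w) : Pi_ab w :=
  abpi (@Pi_rel w) (fgen f).

Lemma Pi_gen_comp (w : fobj presented) (v : path1 (fsrc w) (ftgt w)) (e : pbar v = fcell w)
    (f g : tcell v v) :
  Pi_gen (Closed2 (tcomp1 f g) e) = Pi_gen (Closed2 f e) + Pi_gen (Closed2 g e).
Proof.
apply/eqP; rewrite -subr_eq0 /Pi_gen -raddfD -raddfB; apply/eqP.
exact/abpi_rel/PR_comp.
Qed.

Lemma Pi_gen_cycl (w : fobj presented) (v v' : path1 (fsrc w) (ftgt w)) (e : pbar v = fcell w)
    (e' : pbar v' = fcell w) (f : tcell v v') (g : tcell v' v) :
  Pi_gen (Closed2 (tcomp1 f g) e) = Pi_gen (Closed2 (tcomp1 g f) e').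
Proof.
apply/eqP; rewrite -subr_eq0 /Pi_gen -raddfB; apply/eqP.
exact/abpi_rel/PR_cycl.
Qed.

Lemma Pi_ext (w : fobj presented) (M : zmodType) (f h : {additive Pi_ab w -> M}) :
  (forall c, f (Pi_gen c) = h (Pi_gen c)) -> f =1 h.
Proof.
move=> fh q; have [x ->] := abpi_surj q.
exact: (freeab_ext (f := f \o abpi (@Pi_rel w)) (h := h \o abpi (@Pi_rel w))).
Qed.

Lemma Closed2_teq (w : fobj presented) (u v : path1 (fsrc w) (ftgt w)) (e : pbar u = fcell w)
    (e' : pbar v = fcell w) (f : term2 u u) (g : term2 v v) :
  teq f g -> Closed2 (tpi f) e = Closed2 (tpi g) e'.
Proof.
move=> fg; have [uv _] := teq_boundary fg; subst v.
have -> : e' = e by exact: Prop_irrelevance.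
by congr Closed2; apply/cpiP.
Qed.

Lemma whisk_bar (w w' : fobj presented) (m : fhom w w') (a : path1 (fsrc w') (fsrc w))
    (b : path1 (ftgt w) (ftgt w')) (v : path1 (fsrc w) (ftgt w)) :
  pbar a = fleft m -> pbar b = fright m -> pbar v = fcell w ->
  pbar (pcat (pcat a v) b) = fcell w'.
Proof. by move=> ea eb ev; rewrite -(fhomE m) -ea -eb -ev !pbar_cat. Qed.

(* [crepr a] is a chosen 1-cell representing [a]; other choices give the same
   element, see [Pi_actE]. *)
Definition closed2_act (w w' : fobj presented) (m : fhom w w') (c : closed2 w) : closed2 w' :=
  Closed2 (twhisk (crepr (fleft m)) (crepr (fright m)) (cl2 c))
    (whisk_bar (creprK (fleft m)) (creprK (fright m)) (clE c)).

Lemma Twhisk_V x y z t (a : path1 x y) (u v w : path1 y z) (b : path1 z t)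
  (f : term2 u v) (g : term2 v w) :
  teq (Twhisk a b (TV f g)) (TV (Twhisk a b f) (Twhisk a b g)).
Proof.
have V11 x' y' (p : path1 x' y') : teq (TId p) (TV (TId p) (TId p)).
  exact/TE_sym/TE_V1l.
apply: TE_trans (TE_HV _ _ _ _); apply: TE_H (V11 _ _ _).
apply: TE_trans (TE_HV _ _ _ _); apply: TE_H (V11 _ _ _) _; exact: TE_refl.
Qed.

Lemma twhisk_comp1 x y z t (a : path1 x y) (u v w : path1 y z) (b : path1 z t)
  (f : tcell u v) (g : tcell v w) :
  twhisk a b (tcomp1 f g) = tcomp1 (twhisk a b f) (twhisk a b g).
Proof.
have [[f' ->] [g' ->]] := (tpi_surj f, tpi_surj g).
rewrite tpi_comp1 !tpi_whisk tpi_comp1; apply/cpiP; exact: Twhisk_V.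
Qed.

Lemma Pi_act_subproof (w w' : fobj presented) (m : fhom w w') x : Pi_rel x ->
  freelift (fun c => Pi_gen (closed2_act m c)) x = 0.
Proof.
case=> [v e f g|v v' e e' f g].
- rewrite raddfB raddfD !freeliftE; apply/eqP; rewrite subr_eq0; apply/eqP.
  by rewrite /closed2_act /= twhisk_comp1 Pi_gen_comp.
- rewrite raddfB !freeliftE; apply/eqP; rewrite subr_eq0; apply/eqP.
  rewrite /closed2_act /= !twhisk_comp1; exact: Pi_gen_cycl.
Qed.

Definition Pi_act (w w' : fobj presented) (m : fhom w w') : {additive Pi_ab w -> Pi_ab w'} :=
  ablift (@Pi_act_subproof w w' m).

Lemma TV_exch x y z (u u' : path1 x y) (v v' : path1 y z)
    (f : term2 u u') (g : term2 v v') :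
  teq (TV (TH f (TId v)) (TH (TId u') g)) (TV (TH (TId u) g) (TH f (TId v'))).
Proof.
apply: TE_trans (TE_sym (TE_HV _ _ _ _)) _; apply: TE_trans (TE_HV _ _ _ _).
by apply: TE_H;
  [apply: TE_trans (TE_V1r _) (TE_sym (TE_V1l _))
  |apply: TE_trans (TE_V1l _) (TE_sym (TE_V1r _))].
Qed.

Lemma Pi_gen_conj (w : fobj presented) (v v' : path1 (fsrc w) (ftgt w)) (e : pbar v = fcell w)
    (e' : pbar v' = fcell w) (f : term2 v v) (f' : term2 v' v') (h : term2 v v') :
  teq (TV f h) (TV h f') -> Pi_gen (Closed2 (tpi f) e) = Pi_gen (Closed2 (tpi f') e').
Proof.
move=> fh.
have -> : tpi f = tcomp1 (tpi h) (tcomp1 (tpi f') (tpi (TInv h))).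
  rewrite !tpi_comp1; apply/cpiP.
  apply: TE_trans (TE_sym (TE_VA _ _ _)); apply: TE_sym.
  apply: TE_trans (TE_V (TE_sym fh) (TE_refl _)) _.
  apply: TE_trans (TE_sym (TE_VA _ _ _)) _.
  exact: TE_trans (TE_V (TE_refl _) (TE_VInvr _)) (TE_V1r _).
rewrite (Pi_gen_cycl e e'); congr (Pi_gen (Closed2 _ _)).
rewrite !tpi_comp1; apply/cpiP.
apply: TE_trans (TE_sym (TE_VA _ _ _)) _.
exact: TE_trans (TE_V (TE_refl _) (TE_VInvl _)) (TE_V1r _).
Qed.

Lemma Pi_actE (w w' : fobj presented) (m : fhom w w') (a : path1 (fsrc w') (fsrc w))
    (b : path1 (ftgt w) (ftgt w')) (v : path1 (fsrc w) (ftgt w))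
    (f : tcell v v) (ea : pbar a = fleft m) (eb : pbar b = fright m)
    (e : pbar v = fcell w) :
  Pi_act m (Pi_gen (Closed2 f e)) =
  Pi_gen (Closed2 (twhisk a b f) (whisk_bar ea eb e)).
Proof.
rewrite /Pi_act abliftE freeliftE /closed2_act /=.
have [h] : inhabited (term2 (crepr (fleft m)) a).
  by apply/pcong_term2/(cpiP (pcong_equiv _ _)); rewrite creprK.
have [k] : inhabited (term2 (crepr (fright m)) b).
  by apply/pcong_term2/(cpiP (pcong_equiv _ _)); rewrite creprK.
have [f' ->] := tpi_surj f; rewrite !tpi_whisk.
apply: (@Pi_gen_conj _ _ _ _ _ _ _ (TH (TH h (TId v)) k)); rewrite /Twhisk.
apply: TE_trans (TE_sym (TE_HV _ _ _ _)) _; apply: TE_trans (TE_HV _ _ _ _).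
apply: TE_H; last exact: TE_trans (TE_V1l _) (TE_sym (TE_V1r _)).
exact/TE_sym/TV_exch.
Qed.

Definition Pi : natsys presented.
Proof.
refine (@AbFunctor (factcat presented) Pi_ab Pi_act _ _).
- move=> w; apply: (Pi_ext (h := idfun)) => -[v f e] /=.
  rewrite [LHS](@Pi_actE w w (fid w) (pnil _) (pnil _) _ f erefl erefl e).
  have [f' ->] := tpi_surj f; rewrite tpi_whisk; congr Pi_gen.
  by apply: Closed2_teq; apply: TE_trans (TE_H1r _) (TE_H1l _).
- move=> w w' w'' m m'.
  apply: (Pi_ext (h := Pi_act m' \o Pi_act m)) => -[v f e].
  have ea := creprK (fleft m); have eb := creprK (fright m).
  have ea' := creprK (fleft m'); have eb' := creprK (fright m').
  transitivity (Pi_act m' (Pi_act m (Pi_gen (Closed2 f e)))); last by [].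
  rewrite (Pi_actE f ea eb e) (Pi_actE _ ea' eb').
  have ec : pbar (pcat (crepr (fleft m')) (crepr (fleft m))) = fleft (fcomp m m').
    by rewrite pbar_cat; congr pcomp.
  have ed : pbar (pcat (crepr (fright m)) (crepr (fright m'))) = fright (fcomp m m').
    by rewrite pbar_cat; congr pcomp.
  rewrite [LHS](@Pi_actE w w'' (fcomp m m') _ _ v f ec ed e).
  have [f' ->] := tpi_surj f; rewrite !tpi_whisk; congr Pi_gen.
  apply: Closed2_teq; rewrite /Twhisk.
  apply: TE_trans (TE_H (TE_refl _) (TE_sym (TE_HId _ _))) _.
  apply: TE_trans (TE_HA _ _ _) _; apply: TE_H (TE_refl _).
  apply: TE_trans _ (TE_sym (TE_HA _ _ _)).
  apply: TE_H (TE_refl _).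
  apply: TE_trans (TE_H (TE_sym (TE_HId _ _)) (TE_refl _)) _.
  exact: TE_sym (TE_HA _ _ _).
Defined.

End Polygraph.

(* Main.v *)
(* For a 2-cell f : u => v of the free (2,1)-category and 1-cells a, b of the
   presented category, let a[f]b be the linearisation of f in F[Sigma_2]; it is
   well defined and delta_2 (a[f]b) = a[u]b - a[v]b, so that f |-> [f] induces a
   natural map phi : Pi -> h_2.

   For the inverse, choose a representative rep c of every 1-cell c and, for
   every generator x, a 2-cell nu (x, c) : x (rep c) => rep (x c).  By recursion
   this gives theta_p : p => rep p with theta_(x p) = (x theta_p) nu (x, p).
   Closing up 2-cells f : p => q to loops L f = theta_p^- f theta_q is additive
   and, by the recursion, L (a f) = a L f; exchange then shows that L (f b)
   depends only on f and the class of b.  Hence psi (a[alpha]b) = L (a alpha b)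
   defines psi : F[Sigma_2] -> Pi, and psi (a[f]b) = L (a f b) for all f, by
   induction on f; in particular psi \o phi is the identity.

   Finally, the K : F[Sigma_1] -> F[Sigma_2] with K (a[x]b) = a[nu (x, b)]
   satisfies [theta_(p u)] = K ([p]u) + p[theta_u], whence
   phi \o psi = id - K \o delta_2, which is the identity on h_2 = ker delta_2. *)

From mathcomp Require Import all_boot ssralg boolp.
Require Import Defs.

Set Implicit Arguments.
Unset Strict Implicit.
Unset Printing Implicit Defensive.

Import GRing.Theory.
Local Open Scope ring_scope.

(** Writing an argument as [f w (g w a)] transfers naturality from [f] to its componentwise inverse,
    so the isomorphism only calls for [phi] to be natural. *)
Lemma natiso_inv (K : category) (D E : abfunctor K) (f : nattrans D E)
    (g : forall w, {additive E w -> D w}) :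
  (forall w, cancel (f w) (g w)) -> (forall w, cancel (g w) (f w)) -> natiso E D.
Proof.
move=> fK gK.
have gnat w w' (m : hom w w') a : g w' (afact E m a) = afact D m (g w a).
  by rewrite -[in LHS](gK w a) -ntnat fK.
by exists (NatTrans gnat), f.
Qed.

Lemma kerval_inj (V W : zmodType) (f : {additive V -> W}) : injective (@kerval _ _ f).
Proof. exact: val_inj. Qed.

Lemma kervalD (V W : zmodType) (f : {additive V -> W}) (a b : kerab f) :
  kerval (a + b) = kerval a + kerval b.
Proof. by []. Qed.

Lemma afact_fcomp (C : category) (D : natsys C) (w w' w'' : fobj C) (m : fhom w w')
    (m' : fhom w' w'') (a : D w) : afact D m' (afact D m a) = afact D (fcomp m m') a.
Proof. exact/esym/(@afactM _ D). Qed.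

Section Syzygies.
Variable S : polygraph2.
Local Notation path1 := (path (@cells1 S)).
Local Notation fhomS := (@fhom (presented S)).
Local Notation fobjS := (@fobj (presented S)).
Local Notation FObjS := (@FObj (presented S)).

(** ** Linearisation of 2-cells *)

Lemma pbar_term2 x y (u v : path1 x y) : term2 u v -> pbar u = pbar v.
Proof. by move=> f; apply/cpiP/pcong_term2. Qed.

(* [tsym f (a, b)] is the element a[f]b. *)
Fixpoint tsym x y (u v : path1 x y) (f : term2 u v) (w : fobjS) {struct f} :
    fhomS (bobj u) w -> FC2 S w :=
  match f in @term2 _ x y u v return fhomS (bobj u) w -> FC2 S w with
  | TGen _ _ _ _ phi => fun m => fgen (existT _ (Sigma2 phi) m)
  | TId _ _ _ => fun=> 0
  | TInv _ _ _ _ f => fun m => - tsym f (fcomp (coerm (pbar_term2 f)) m)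
  | TV _ _ _ _ _ f g => fun m =>
      tsym f m + tsym g (fcomp (coerm (esym (pbar_term2 f))) m)
  | TH _ _ _ u _ v _ f g => fun m =>
      tsym f (fcomp (rightm u v) m) + tsym g (fcomp (leftm u v) m)
  end.

Lemma tsym1 x y (u : path1 x y) (w : fobjS) (m : fhomS (bobj u) w) :
  tsym (TId u) m = 0.
Proof. by []. Qed.

Lemma tsymN x y (u v : path1 x y) (f : term2 u v) (w : fobjS) (m : fhomS (bobj v) w) :
  tsym (TInv f) m = - tsym f (fcomp (coerm (pbar_term2 f)) m).
Proof. by []. Qed.

Lemma tsymV x y (u v u' : path1 x y) (f : term2 u v) (g : term2 v u') (w : fobjS)
    (m : fhomS (bobj u) w) :
  tsym (TV f g) m = tsym f m + tsym g (fcomp (coerm (esym (pbar_term2 f))) m).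
Proof. by []. Qed.

Lemma tsymH x y z (u u' : path1 x y) (v v' : path1 y z) (f : term2 u u')
    (g : term2 v v') (w : fobjS) (m : fhomS (bobj (pcat u v)) w) :
  tsym (TH f g) m = tsym f (fcomp (rightm u v) m) + tsym g (fcomp (leftm u v) m).
Proof. by []. Qed.

Definition tsymE := (tsym1, tsymN, tsymV, tsymH).

Lemma tsym_ext x y (u v : path1 x y) (f : term2 u v) (w : fobjS)
    (m n : fhomS (bobj u) w) :
  fleft m = fleft n -> fright m = fright n -> tsym f m = tsym f n.
Proof. by move=> ml mr; rewrite (fhom_ext ml mr). Qed.

Lemma pcompA x y z t (a : @pcell S x y) (b : @pcell S y z) (c : @pcell S z t) :
  @pcomp S _ _ _ a (pcomp b c) = pcomp (pcomp a b) c.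
Proof. exact: (@compA (presented S)). Qed.

Lemma pcomp1m x y (a : @pcell S x y) : pcomp (pbar (@pnil (cells0 S) (@cells1 S) x)) a = a.
Proof. exact: (@comp1m (presented S)). Qed.

Lemma pcompm1 x y (a : @pcell S x y) : pcomp a (pbar (@pnil (cells0 S) (@cells1 S) y)) = a.
Proof. exact: (@compm1 (presented S)). Qed.

Definition pcompE := (pbar_cat, pcomp1m, pcompm1, pcompA).

(** The context reaches the generators by composition only, so a further action just extends it.
    Naturality of [phi] rests on this. *)
Lemma tsym_act x y (u v : path1 x y) (f : term2 u v) (w w' : fobjS)
    (m : fhomS (bobj u) w) (n : fhomS w w') :
  afact (FC2 S) n (tsym f m) = tsym f (fcomp m n).
Proof.
elim: f w w' m n => {x y u v}.
- by move=> x y u v phi w w' m n; rewrite [LHS]freeliftE.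
- by move=> x y u w w' m n; rewrite tsymE raddf0.
- move=> x y u v f IH w w' m n; rewrite tsymE raddfN IH; congr (- _).
  by apply: tsym_ext; rewrite /= ?pcompE.
- move=> x y u v u' f IHf g IHg w w' m n; rewrite tsymE raddfD IHf IHg.
  by congr (_ + _); apply: tsym_ext; rewrite /= ?pcompE.
- move=> x y z u u' v v' f IHf g IHg w w' m n; rewrite tsymE raddfD IHf IHg.
  by congr (_ + _); apply: tsym_ext; rewrite /= ?pcompE.
Qed.

(** Inverse laws become cancellation and exchange becomes commutativity of addition. Contexts are
    compared by components because equivalent terms have boundaries equal only propositionally. *)
Lemma tsym_teq x y (u v u' v' : path1 x y) (f : term2 u v) (f' : term2 u' v') :
  teq f f' -> forall (w : fobjS) (m : fhomS (bobj u) w) (m' : fhomS (bobj u') w),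
  fleft m = fleft m' -> fright m = fright m' -> tsym f m = tsym f' m'.
Proof.
elim=> {x y u v u' v' f f'}.
- by move=> x y u v f w m m' *; apply: tsym_ext.
- by move=> x y u v u' v' f f' _ IH w m m' ml mr; rewrite (IH w m' m).
- move=> x y u v u' v' u'' v'' f f' f'' e1 IH1 e2 IH2 w m m'.
  have eu : pbar u = pbar u' by case: (teq_boundary e1) => ->.
  move=> ml mr; rewrite (IH1 w m (fcomp (coerm (esym eu)) m)) ?(IH2 w _ m') //=;
    by rewrite ?pcompE.
- move=> x y u v u' v' f f' e IH w m m' ml mr; rewrite !tsymE; congr (- _).
  by apply: IH; rewrite /= ?ml ?mr.
- move=> x y u v r u' v' r' f g f' g' ef IHf eg IHg w m m' ml mr; rewrite !tsymE.
  by congr (_ + _); [apply: IHf | apply: IHg]; rewrite /= ?ml ?mr.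
- move=> x y z u v u' v' s t s' t' f g f' g' ef IHf eg IHg w m m' ml mr; rewrite !tsymE.
  have [? _] := teq_boundary ef; have [? _] := teq_boundary eg; subst.
  by congr (_ + _); [apply: IHf | apply: IHg]; rewrite /= ?ml ?mr.
- move=> x y u v r t f g h w m m' ml mr; rewrite !tsymE addrA.
  by congr (_ + _ + _); apply: tsym_ext; rewrite /= ?ml ?mr ?pcompE.
- move=> x y u v f w m m' ml mr; rewrite !tsymE add0r.
  by apply: tsym_ext; rewrite /= ?ml ?mr ?pcompE.
- move=> x y u v f w m m' ml mr; rewrite !tsymE addr0.
  by apply: tsym_ext; rewrite /= ?ml ?mr ?pcompE.
- move=> x y u v f w m m' ml mr; rewrite !tsymE; apply/eqP; rewrite subr_eq0; apply/eqP.
  by apply: tsym_ext; rewrite /= ?ml ?mr ?pcompE.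
- move=> x y u v f w m m' ml mr; rewrite !tsymE addrC; apply/eqP; rewrite subr_eq0; apply/eqP.
  by apply: tsym_ext; rewrite /= ?ml ?mr ?pcompE.
- move=> x y z t u u' v v' r r' f g h w m m' ml mr; rewrite !tsymE addrA.
  by congr (_ + _ + _); apply: tsym_ext; rewrite /= ?ml ?mr ?pcompE.
- move=> x y u v f w m m' ml mr; rewrite !tsymE add0r.
  by apply: tsym_ext; rewrite /= ?ml ?mr ?pcompE.
- move=> x y u v f w m m' ml mr; rewrite !tsymE addr0.
  by apply: tsym_ext; rewrite /= ?ml ?mr ?pcompE.
- by move=> *; rewrite !tsymE addr0.
- move=> x y z u u' u'' v v' v'' f f' g g' w m m' ml mr; rewrite !tsymE.
  rewrite addrACA; congr (_ + _ + (_ + _)); apply: tsym_ext;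
    by rewrite /= ?ml ?mr ?pcompE ?(pbar_term2 f) ?(pbar_term2 g).
Qed.

Lemma bracket_cat_act x y z (u : path1 x y) (v : path1 y z) (w : fobjS)
    (m : fhomS (bobj (pcat u v)) w) :
  afact (FC1 S) m (bracket (pcat u v)) =
  afact (FC1 S) (fcomp (rightm u v) m) (bracket u)
  + afact (FC1 S) (fcomp (leftm u v) m) (bracket v).
Proof.
by rewrite bracket_cat raddfD !(@afact_fcomp _ (FC1 S)).
Qed.

Lemma bracket_cons_act x y z (e : cells1 x y) (u : path1 y z) (w : fobjS)
    (m : fhomS (bobj (pcons e u)) w) :
  afact (FC1 S) m (bracket (pcons e u)) =
  afact (FC1 S) (fcomp (rightm (pone e) u) m) (symb1 e)
  + afact (FC1 S) (fcomp (leftm (pone e) u) m) (bracket u).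
Proof.
by rewrite [bracket _]/= raddfD !(@afact_fcomp _ (FC1 S)).
Qed.

(** Vertical composites telescope, and horizontal ones split by the derivation rule for brackets.
    Both [m] and [n] are the same pair, seen from [bobj u] and from [bobj v]. *)
Lemma delta2_tsym x y (u v : path1 x y) (f : term2 u v) (w : fobjS)
    (m : fhomS (bobj u) w) (n : fhomS (bobj v) w) :
  fleft m = fleft n -> fright m = fright n ->
  delta2 S w (tsym f m) = afact (FC1 S) m (bracket u) - afact (FC1 S) n (bracket v).
Proof.
elim: f w m n => {x y u v}.
- move=> x y u v phi w m n ml mr; rewrite [LHS]freeliftE raddfB; congr (_ - _).
  rewrite [LHS](@afact_fcomp _ (FC1 S)); congr (afact _ _ _).
  by apply: fhom_ext; rewrite /= ?ml ?mr ?pcompE.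
- by move=> x y u w m n ml mr; rewrite raddf0 (fhom_ext ml mr) subrr.
- move=> x y u v f IH w m n ml mr; rewrite tsymE raddfN (IH _ _ m) ?opprB.
  + congr (_ - afact _ _ _).
    by apply: fhom_ext; rewrite /= ?ml ?mr ?pcompE.
  + by rewrite /= pcompE.
  + by rewrite /= pcompE.
- move=> x y u v u' f IHf g IHg w m n ml mr; rewrite tsymE raddfD.
  set m' := fcomp _ m.
  rewrite (IHf _ _ m') ?(IHg _ _ n) ?subrKA //= ?pcompE //.
- move=> x y z u u' v v' f IHf g IHg w m n ml mr; rewrite tsymE raddfD.
  rewrite (IHf _ _ (fcomp (rightm u' v') n)) ?(IHg _ _ (fcomp (leftm u' v') n)) //=
    ?ml ?mr ?(pbar_term2 f) ?(pbar_term2 g) //.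
  by rewrite !bracket_cat_act opprD addrACA.
Qed.

(** ** Normalisation and loops *)

(** The congruence only gives inhabitation, so [cid] selects a 2-cell; no coherence between the
    selected cells is assumed. *)
Lemma some_term2 x y (u v : path1 x y) : pbar u = pbar v -> term2 u v.
Proof.
move=> /cpiP/pcong_term2 uv.
by have /cid[f] : exists f : term2 u v, True by case: uv => f; exists f.
Qed.

Lemma pbar_crepr x y (a : @pcell S x y) : pbar (crepr a) = a.
Proof. exact: creprK. Qed.

Lemma nu_subproof x y z (e : cells1 x y) (a : @pcell S y z) (c : pcell x z) :
  pcomp (pbar (pone e)) a = c -> pbar (pcons e (crepr a)) = pbar (crepr c).
Proof. by move=> <-; rewrite pbar_crepr -{2}[a]pbar_crepr -pbar_cat. Qed.

Definition nu x y z (e : cells1 x y) (a : @pcell S y z) (c : pcell x z)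
    (ac : pcomp (pbar (pone e)) a = c) : term2 (pcons e (crepr a)) (crepr c) :=
  some_term2 (nu_subproof ac).

Lemma pbar_cons x y z (e : cells1 x y) (p : path1 y z) :
  pbar (pcons e p) = pcomp (pbar (pone e)) (pbar p).
Proof. exact: (pbar_cat (pone e) p). Qed.

(* The target is indexed by an arbitrary [c] equal to [pbar p], so that loops over
   parallel 1-cells need no transport. *)
Fixpoint theta x y (p : path1 x y) {struct p} :
    forall c, pbar p = c -> term2 p (crepr c) :=
  match p in path _ x y return forall c : pcell x y, pbar p = c -> term2 p (crepr c) with
  | pnil _ => fun c pc => some_term2 (etrans pc (esym (pbar_crepr c)))
  | pcons _ _ _ e p => fun c pc =>
      TV (TH (TId (pone e)) (theta (erefl (pbar p))))
         (nu (etrans (esym (pbar_cons e p)) pc))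
  end.

Lemma theta_cons x y z (e : cells1 x y) (p : path1 y z) a c (pc : pbar (pcons e p) = c)
    (pa : pbar p = a) (ac : pcomp (pbar (pone e)) a = c) :
  theta pc = TV (TH (TId (pone e)) (theta pa)) (nu ac).
Proof. by subst a; rewrite (Prop_irrelevance ac (etrans (esym (pbar_cons e p)) pc)). Qed.

(** * Inverses and whiskering of 2-cells *)

Lemma teq_inv x y (u v : path1 x y) (f : term2 u v) (g : term2 v u) :
  teq (TV f g) (TId u) -> teq g (TInv f).
Proof.
move=> fg; apply: TE_trans (TE_sym (TE_V1l g)) _.
apply: TE_trans (TE_V (TE_sym (TE_VInvl f)) (TE_refl g)) _.
apply: TE_trans (TE_sym (TE_VA _ _ _)) _.
exact: TE_trans (TE_V (TE_refl _) fg) (TE_V1r _).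
Qed.

Lemma lwhiskV x y z (a : path1 x y) (u v w : path1 y z) (f : term2 u v) (g : term2 v w) :
  teq (TH (TId a) (TV f g)) (TV (TH (TId a) f) (TH (TId a) g)).
Proof. exact: TE_trans (TE_H (TE_sym (TE_V1l _)) (TE_refl _)) (TE_HV _ _ _ _). Qed.

Lemma rwhiskV x y z (b : path1 y z) (u v w : path1 x y) (f : term2 u v) (g : term2 v w) :
  teq (TH (TV f g) (TId b)) (TV (TH f (TId b)) (TH g (TId b))).
Proof. exact: TE_trans (TE_H (TE_refl _) (TE_sym (TE_V1l _))) (TE_HV _ _ _ _). Qed.

Lemma lwhisk_inv x y z (a : path1 x y) (u v : path1 y z) (f : term2 u v) :
  teq (TH (TId a) (TInv f)) (TInv (TH (TId a) f)).
Proof.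
apply: teq_inv; apply: TE_trans (TE_sym (lwhiskV _ _ _)) _.
exact: TE_trans (TE_H (TE_refl _) (TE_VInvr _)) (TE_HId _ _).
Qed.

(** Since [theta] recurses on the leftmost generator, normalising [pcat a p] begins by normalising
    [p]. The remainder [k] depends on [a] and the class [c] but not on [p], and this uniformity
    makes loops commute with left whiskering. *)
Lemma theta_cat x y z (a : path1 x y) (c : pcell y z) (d : pcell x z) :
  pcomp (pbar a) c = d ->
  exists k : term2 (pcat a (crepr c)) (crepr d),
    forall (p : path1 y z) (pc : pbar p = c) (pd : pbar (pcat a p) = d),
    teq (theta pd) (TV (TH (TId a) (theta pc)) k).
Proof.
elim: a c d => [x'|x' y' z' e a IH] c d acd.
  rewrite pcomp1m in acd; subst d; exists (TId (crepr c)) => p pc pd /=.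
  rewrite (Prop_irrelevance pd pc); apply: TE_sym; apply: TE_trans (TE_V1r _) _.
  exact: TE_H1l.
have [k kE] := IH c (pcomp (pbar a) c) erefl.
have ed : pcomp (pbar (pone e)) (pcomp (pbar a) c) = d by rewrite pcompA -pbar_cat.
(* The new remainder whiskers the old one by [e], then applies the chosen 2-cell for [e]. *)
exists (TV (TH (TId (pone e)) k) (nu ed)) => p pc pd.
have pd' : pbar (pcat a p) = pcomp (pbar a) c by rewrite pbar_cat pc.
rewrite (theta_cons pd pd' ed).
apply: TE_trans (TE_V (TE_H (TE_refl (TId (pone e))) (kE p pc pd')) (TE_refl (nu ed))) _.
apply: TE_trans _ (TE_sym (TE_VA _ _ _)); apply: TE_V (TE_refl _).
apply: TE_trans (TE_H (TE_sym (TE_V1l _)) (TE_refl _)) _.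
apply: TE_trans (TE_HV _ _ _ _) _; apply: TE_V (TE_refl _).
apply: TE_trans (TE_HA (TId (pone e)) (TId a) (theta pc)) _.
refine (TE_H (f:=TH (TId (pone e)) (TId a)) (f' := TId (pcons e a)) _ (TE_refl (theta pc))).
exact: TE_HId.
Qed.

(** * Loops at the chosen representatives *)

Definition theta_loop x y (c : @pcell S x y) (p q : path1 x y) (pc : pbar p = c)
    (qc : pbar q = c) (f : term2 p q) : term2 (crepr c) (crepr c) :=
  TV (TInv (theta pc)) (TV f (theta qc)).

(** All loops over [w] share the base point [crepr (fcell w)], so 2-cells with different boundaries
    get classes that can be added. *)
Definition loopcl (w : fobjS) (p q : path1 (fsrc w) (ftgt w))
    (pw : pbar p = fcell w) (qw : pbar q = fcell w) (f : term2 p q) : Pi_ab w :=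
  Pi_gen (Closed2 (tpi (theta_loop pw qw f)) (pbar_crepr (fcell w))).

Lemma loopcl_teq (w : fobjS) (p q p' q' : path1 (fsrc w) (ftgt w))
    (pw : pbar p = fcell w) (qw : pbar q = fcell w)
    (pw' : pbar p' = fcell w) (qw' : pbar q' = fcell w)
    (f : term2 p q) (f' : term2 p' q') :
  teq f f' -> loopcl pw qw f = loopcl pw' qw' f'.
Proof.
move=> ff'; have [? ?] := teq_boundary ff'; subst p' q'.
rewrite (Prop_irrelevance pw' pw) (Prop_irrelevance qw' qw).
congr Pi_gen; apply: Closed2_teq.
by apply: TE_V (TE_refl _) (TE_V ff' (TE_refl _)).
Qed.

Lemma loopclV (w : fobjS) (p q r : path1 (fsrc w) (ftgt w))
    (pw : pbar p = fcell w) (qw : pbar q = fcell w) (rw : pbar r = fcell w)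
    (f : term2 p q) (g : term2 q r) :
  loopcl pw rw (TV f g) = loopcl pw qw f + loopcl qw rw g.
Proof.
rewrite /loopcl -Pi_gen_comp tpi_comp1; congr Pi_gen; apply: Closed2_teq.
apply: TE_trans _ (TE_VA _ _ _); apply: TE_V (TE_refl _) _.
apply: TE_trans (TE_sym (TE_VA _ _ _)) _.
apply: TE_trans _ (TE_VA _ _ _); apply: TE_V (TE_refl _) _.
apply: TE_sym; apply: TE_trans (TE_VA _ _ _) _.
by apply: TE_trans (TE_V (TE_VInvr _) (TE_refl _)) (TE_V1l _).
Qed.

Lemma loopcl1 (w : fobjS) (p : path1 (fsrc w) (ftgt w)) (pw pw' : pbar p = fcell w) :
  loopcl pw pw' (TId p) = 0.
Proof.
(* An identity is idempotent, so its class equals its own double. *)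
rewrite (Prop_irrelevance pw' pw); apply: (addrI (loopcl pw pw (TId p))).
by rewrite -loopclV addr0; apply: loopcl_teq; apply: TE_V1l.
Qed.

(** The loop of a closed [f] is its conjugate by [theta], and conjugate cells have the same
    class. *)
Lemma loopcl_closed (w : fobjS) (p : path1 (fsrc w) (ftgt w))
    (pw pw' : pbar p = fcell w) (f : term2 p p) :
  loopcl pw pw' f = Pi_gen (Closed2 (tpi f) pw).
Proof.
rewrite (Prop_irrelevance pw' pw).
apply: (@Pi_gen_conj _ _ _ _ _ _ _ _ (TInv (theta pw))).
apply: TE_trans (TE_sym (TE_VA _ _ _)) _; apply: TE_V (TE_refl _) _.
apply: TE_trans (TE_sym (TE_VA _ _ _)) _.
exact: TE_trans (TE_V (TE_refl _) (TE_VInvr _)) (TE_V1r _).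
Qed.

Lemma fhom_lE x y z (c : @pcell S y z) (d : pcell x z) (m : fhomS (FObjS c) (FObjS d)) :
  fright m = idm (z : presented S) -> pcomp (fleft m) c = d.
Proof. by move=> mr; have := fhomE m; rewrite mr /= pcompm1. Qed.

(** By [theta_cat], the [theta] cells at source and target leave the same remainder [k], which
    conjugates the whiskered loop of [f] into the loop of the whiskered [f]. *)
Lemma loopcl_left x y z (a : path1 x y) (c : pcell y z) (d : pcell x z)
    (m : fhomS (FObjS c) (FObjS d)) (p q : path1 y z) (f : term2 p q)
    (pc : pbar p = c) (qc : pbar q = c)
    (pd : pbar (pcat a p) = d) (qd : pbar (pcat a q) = d) :
  pbar a = fleft m -> fright m = idm (z : presented S) ->
  Pi_act m (@loopcl (FObjS c) p q pc qc f) =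
  @loopcl (FObjS d) _ _ pd qd (TH (TId a) f).
Proof.
move=> am mr.
have mb : pbar (pnil z) = fright m by rewrite mr.
have [k kE] : exists k : term2 (pcat a (crepr c)) (crepr d),
    forall (p : path1 y z) (pc : pbar p = c) (pd : pbar (pcat a p) = d),
    teq (theta pd) (TV (TH (TId a) (theta pc)) k).
  by apply: theta_cat; rewrite am fhom_lE.
rewrite /loopcl (@Pi_actE S (FObjS c) (FObjS d) m a (pnil z) _ _ am mb) tpi_whisk.
have ad : pbar (pcat a (crepr c)) = d by rewrite pbar_cat pbar_crepr am fhom_lE.
transitivity (Pi_gen (@Closed2 _ (FObjS d) _
    (tpi (TH (TId a) (theta_loop pc qc f))) ad)).
  by congr Pi_gen; apply: Closed2_teq; apply: TE_H1r.
apply: (@Pi_gen_conj S (FObjS d) _ _ _ _ _ _ k).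
have AI r (rc : pbar r = c) (rd : pbar (pcat a r) = d) :
    teq (TV k (TInv (theta rd))) (TInv (TH (TId a) (theta rc))).
  apply: teq_inv; apply: TE_trans (TE_VA _ _ _) _.
  apply: TE_trans (TE_V (TE_sym (kE r rc rd)) (TE_refl _)) _; exact: TE_VInvr.
apply: TE_trans (TE_V (lwhiskV _ _ _) (TE_refl _)) _.
apply: TE_trans (TE_sym (TE_VA _ _ _)) _; apply: TE_trans _ (TE_sym (TE_VA _ _ _)).
apply: TE_V; first exact: TE_trans (lwhisk_inv _ _) (TE_sym (AI _ _ _)).
apply: TE_trans (TE_V (lwhiskV _ _ _) (TE_refl _)) _.
apply: TE_trans (TE_sym (TE_VA _ _ _)) _; apply: TE_V (TE_refl _) _.
exact/TE_sym/kE.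
Qed.

(** ** The map from [FC2] to [Pi] *)

(** Exchanging [f] with a 2-cell [h] from [u] to [u'] decomposes one composite in two ways. The
    loops of [h] whiskered by [p] and by [q] are both the left translate of the loop of [h] by the
    common class of [p] and [q], so they cancel. *)
Lemma loopcl_right x y z (p q : path1 x y) (u u' : path1 y z) (d : pcell x z)
    (f : term2 p q) (pu : pbar (pcat p u) = d) (qu : pbar (pcat q u) = d)
    (pu' : pbar (pcat p u') = d) (qu' : pbar (pcat q u') = d) :
  pbar u = pbar u' ->
  @loopcl (FObjS d) _ _ pu qu (TH f (TId u)) =
  @loopcl (FObjS d) _ _ pu' qu' (TH f (TId u')).
Proof.
move=> uu'; pose h := some_term2 uu'.
have dE : comp (comp (pbar p : @hom (presented S) x y) (pbar u)) (idm (z : presented S)) = d.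
  by rewrite -pu compm1 [RHS]pbar_cat.
pose m := @FHom _ (FObjS (pbar u)) (FObjS d) _ _ dE.
have pq := pbar_term2 f.
have ph := loopcl_left (m := m) h erefl (esym uu') pu pu' erefl erefl.
have qh := loopcl_left (m := m) h erefl (esym uu') qu qu' (esym pq) erefl.
have := @loopcl_teq (FObjS d) _ _ _ _ pu qu' pu qu' _ _ (TV_exch f h).
rewrite (@loopclV (FObjS d) _ _ _ pu qu qu') (@loopclV (FObjS d) _ _ _ pu pu' qu').
rewrite -ph -qh addrC; exact: addrI.
Qed.

(** The bracketing keeps [a] outermost, in the shape that [loopcl_left] expects. *)
Definition ctx x y z t (a : path1 x y) (b : path1 z t) (u v : path1 y z)
    (f : term2 u v) : term2 (pcat a (pcat u b)) (pcat a (pcat v b)) :=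
  TH (TId a) (TH f (TId b)).

Lemma ctx_bar (w : fobjS) x y (u v : path1 x y) (m : fhomS (bobj u) w)
    (a : path1 (fsrc w) x) (b : path1 y (ftgt w)) :
  pbar a = fleft m -> pbar b = fright m -> pbar v = pbar u ->
  pbar (pcat a (pcat v b)) = fcell w.
Proof. by move=> am bm vu; rewrite -(fhomE m) /= !pbar_cat am bm vu pcompA. Qed.

Definition psi (w : fobjS) x y (u v : path1 x y) (f : term2 u v)
    (m : fhomS (bobj u) w) : Pi_ab w :=
  loopcl (ctx_bar (pbar_crepr (fleft m)) (pbar_crepr (fright m)) erefl)
         (ctx_bar (pbar_crepr (fleft m)) (pbar_crepr (fright m)) (esym (pbar_term2 f)))
         (ctx (crepr (fleft m)) (crepr (fright m)) f).

(** The left representative enters only through its class by [loopcl_left], and the right one by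
    [loopcl_right]. *)
Lemma psiE (w : fobjS) x y (u v : path1 x y) (f : term2 u v) (m : fhomS (bobj u) w)
    (a : path1 (fsrc w) x) (b : path1 y (ftgt w))
    (au : pbar (pcat a (pcat u b)) = fcell w) (av : pbar (pcat a (pcat v b)) = fcell w) :
  pbar a = fleft m -> pbar b = fright m ->
  loopcl au av (ctx a b f) = psi f m.
Proof.
case: w m a b au av => x0 y0 d m a b /= au av am bm; rewrite /psi.
have ub : @pbar S _ _ (pcat u b) = pcomp (pbar u) (fright m) by rewrite pbar_cat bm.
have vb : @pbar S _ _ (pcat v b) = pcomp (pbar u) (fright m).
  by rewrite pbar_cat bm -(pbar_term2 f).
have ub' : @pbar S _ _ (pcat u (crepr (fright m))) = pcomp (pbar u) (fright m).
  by rewrite pbar_cat pbar_crepr.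
have vb' : @pbar S _ _ (pcat v (crepr (fright m))) = pcomp (pbar u) (fright m).
  by rewrite pbar_cat pbar_crepr -(pbar_term2 f).
have dE : @comp (presented S) _ _ _ (comp (fleft m)
   (pcomp (pbar u) (fright m) : @hom (presented S) x y0)) (idm (y0 : presented S)) = d.
  by rewrite compm1 -[RHS](fhomE m) /= pcompA.
pose n := @FHom _ (FObjS (pcomp (pbar u) (fright m))) (FObjS d) _ _ dE.
rewrite /ctx -(loopcl_left (m := n) _ ub vb _ _ am erefl).
rewrite -(loopcl_left (m := n) _ ub' vb' _ _ (pbar_crepr _) erefl).
congr (Pi_act _ _); apply: loopcl_right; by rewrite pbar_crepr.
Qed.

Lemma psi_teq (w : fobjS) x y (u v u' v' : path1 x y) (f : term2 u v)
    (f' : term2 u' v') (m : fhomS (bobj u) w) (m' : fhomS (bobj u') w) :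
  teq f f' -> fleft m = fleft m' -> fright m = fright m' -> psi f m = psi f' m'.
Proof.
move=> ff' ml mr; have [? ?] := teq_boundary ff'; subst u' v'.
rewrite (fhom_ext ml mr); apply: loopcl_teq.
exact: TE_H (TE_refl _) (TE_H ff' (TE_refl _)).
Qed.

Lemma psi1 (w : fobjS) x y (u : path1 x y) (m : fhomS (bobj u) w) : psi (TId u) m = 0.
Proof.
rewrite /psi -(@loopcl1 w _ (ctx_bar (pbar_crepr (fleft m)) (pbar_crepr (fright m)) erefl)
  (ctx_bar (pbar_crepr (fleft m)) (pbar_crepr (fright m)) erefl)).
apply: loopcl_teq; exact: TE_trans (TE_H (TE_refl _) (TE_HId _ _)) (TE_HId _ _).
Qed.

Lemma psiV (w : fobjS) x y (u v r : path1 x y) (f : term2 u v) (g : term2 v r)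
    (m : fhomS (bobj u) w) (n : fhomS (bobj v) w) :
  fleft m = fleft n -> fright m = fright n ->
  psi (TV f g) m = psi f m + psi g n.
Proof.
move=> ml mr; have am := pbar_crepr (fleft m); have bm := pbar_crepr (fright m).
have uw := ctx_bar am bm erefl.
have vw := ctx_bar am bm (esym (pbar_term2 f)).
have rw := ctx_bar am bm (esym (pbar_term2 (TV f g))).
rewrite -(psiE _ uw rw am bm) -(psiE _ uw vw am bm).
rewrite -(@psiE w _ _ _ _ g n _ _ vw rw (etrans am ml) (etrans bm mr)).
rewrite -loopclV; apply: loopcl_teq.
exact: TE_trans (TE_H (TE_refl _) (rwhiskV _ _ _)) (lwhiskV _ _ _).
Qed.

(** [TH f g] is [f] beside [v] followed by [u'] beside [g]; [psiE] lets the idle 1-cell be absorbed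
    into the context. *)
Lemma psiH (w : fobjS) x y z (u u' : path1 x y) (v v' : path1 y z) (f : term2 u u')
    (g : term2 v v') (m : fhomS (bobj (pcat u v)) w) :
  psi (TH f g) m = psi f (fcomp (rightm u v) m) + psi g (fcomp (leftm u v) m).
Proof.
have am := pbar_crepr (fleft m); have bm := pbar_crepr (fright m).
have fg : teq (TH f g) (TV (TH f (TId v)) (TH (TId u') g)).
  apply: TE_trans (TE_HV _ _ _ _).
  by apply: TE_H; apply: TE_sym; [apply: TE_V1r | apply: TE_V1l].
pose n := fcomp (coerm (esym (pbar_term2 (TH f (TId v))))) m.
have nl : fleft m = fleft n by rewrite /= pcompE.
have nr : fright m = fright n by rewrite /= pcompE.
rewrite (psi_teq (m' := m) fg erefl erefl) (psiV _ _ nl nr); congr (_ + _).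
- rewrite -(@psiE _ _ _ _ _ f _ (crepr (fleft m)) (pcat v (crepr (fright m)))).
  + by rewrite -(fhomE m) /= !pcompE !pbar_crepr.
  + by rewrite -(fhomE m) /= !pcompE !pbar_crepr (pbar_term2 f).
  + move=> uw u'w; apply: loopcl_teq; apply: TE_H (TE_refl _) _.
    by apply: TE_trans (TE_sym (TE_HA _ _ _)) (TE_H (TE_refl _) (TE_HId _ _)).
  + by rewrite /= pcompE pbar_crepr.
  + by rewrite /= pcompE pbar_crepr.
- rewrite -(@psiE _ _ _ _ _ g _ (pcat (crepr (fleft n)) u') (crepr (fright n))).
  + by rewrite -(fhomE m) /= !pcompE !pbar_crepr ?pcompE (pbar_term2 f).
  + by rewrite -(fhomE m) /= !pcompE !pbar_crepr ?pcompE (pbar_term2 f) (pbar_term2 g).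
  + move=> uw u'w; apply: loopcl_teq.
    pose a := crepr (fleft n); pose b := crepr (fright n).
    apply: TE_trans (TE_H (TE_refl (TId a)) (TE_sym (TE_HA (TId u') g (TId b)))) _.
    apply: TE_trans (TE_HA (TId a) (TId u') (TH g (TId b))) _.
    exact: TE_H (TE_HId a u') (TE_refl (TH g (TId b))).
  + by rewrite pbar_cat pbar_crepr -nl /= (pbar_term2 f).
  + by rewrite pbar_crepr -nr /= ?pcompE.
Qed.

Definition psi_lift (w : fobjS) : {additive FC2 S w -> Pi_ab w} :=
  freelift (fun s : fsymb (@bar2 S) w => psi (TGen (cell2 (projT1 s))) (projT2 s)).

(** [tsym] and [psi] obey the same additive rules for every constructor, so agreement on generators
    propagates. *)
Lemma psi_lift_tsym x y (u v : path1 x y) (f : term2 u v) (w : fobjS) (m : fhomS (bobj u) w) :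
  psi_lift w (tsym f m) = psi f m.
Proof.
elim: f w m => {x y u v}.
- by move=> x y u v phi w m; apply: freeliftE.
- by move=> x y u w m; rewrite tsymE raddf0 psi1.
- move=> x y u v f IH w m; rewrite tsymE raddfN IH; set n := fcomp _ m.
  (* Adding [psi f n] reduces the case of an inverse to the vanishing of [psi] on an identity. *)
  apply: (addIr (psi f n)); rewrite addNr -(@psiV _ _ _ _ _ _ _ _ m) /= ?pcompE //.
  by rewrite (psi_teq (m' := m) (TE_VInvl f) erefl erefl) psi1.
- move=> x y u v r f IHf g IHg w m; rewrite tsymE raddfD IHf IHg.
  by rewrite -psiV //= ?pcompE.
- by move=> x y z u u' v v' f IHf g IHg w m; rewrite tsymE raddfD IHf IHg psiH.
Qed.

(** ** The map from [Pi] to [h2] *)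

Lemma closed_hom_subproof (w : fobjS) (p : path1 (fsrc w) (ftgt w)) : pbar p = fcell w ->
  @comp (presented S) _ _ _ (comp (idm (fsrc w)) (pbar p)) (idm (ftgt w)) = fcell w.
Proof. by rewrite compm1 comp1m. Qed.

Definition closed_hom (w : fobjS) (p : path1 (fsrc w) (ftgt w)) (e : pbar p = fcell w) :
    fhomS (bobj p) w :=
  @FHom (presented S) (bobj p) w _ _ (closed_hom_subproof e).

Lemma phi_subproof (w : fobjS) (c : closed2 w) :
  tsym (crepr (cl2 c)) (closed_hom (clE c)) \in kerpred (delta2 S w).
Proof.
rewrite unfold_in (delta2_tsym _ (n := closed_hom (clE c))) //; exact/eqP/subrr.
Qed.

Definition phi_fun (w : fobjS) (c : closed2 w) : kerab (delta2 S w) :=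
  Ker (phi_subproof c).

Lemma val_phi_fun (w : fobjS) (p : path1 (fsrc w) (ftgt w)) (f : term2 p p)
    (e : pbar p = fcell w) :
  kerval (phi_fun (Closed2 (tpi f) e)) = tsym f (closed_hom e).
Proof. by apply: tsym_teq => //; apply: (crepr_pi (teq_equiv p p)). Qed.

Lemma phi_rel (w : fobjS) (x : freeab (closed2 w)) :
  Pi_rel x -> freelift (@phi_fun w) x = 0.
Proof.
case=> [p e f g|p q e e' f g]; apply/eqP.
- have [[f' ->] [g' ->]] := (tpi_surj f, tpi_surj g).
  rewrite raddfB raddfD !freeliftE subr_eq0 tpi_comp1; apply/eqP/kerval_inj.
  rewrite kervalD !val_phi_fun tsymE; congr (_ + _).
  by apply: tsym_ext; rewrite /= ?pcompE.
- have [[f' ->] [g' ->]] := (tpi_surj f, tpi_surj g).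
  rewrite raddfB !freeliftE subr_eq0 !tpi_comp1; apply/eqP/kerval_inj.
  rewrite !val_phi_fun !tsymE addrC.
  by congr (_ + _); apply: tsym_ext; rewrite /= ?pcompE.
Qed.

Definition phi (w : fobjS) : {additive Pi_ab w -> kerab (delta2 S w)} :=
  ablift (@phi_rel w).

Lemma val_phi (w : fobjS) (p : path1 (fsrc w) (ftgt w)) (f : term2 p p)
    (e : pbar p = fcell w) (m : fhomS (bobj p) w) :
  fleft m = idm (fsrc w) -> fright m = idm (ftgt w) ->
  kerval (phi w (Pi_gen (Closed2 (tpi f) e))) = tsym f m.
Proof.
move=> ml mr; rewrite /phi abliftE freeliftE val_phi_fun.
exact: tsym_ext.
Qed.

Definition phi_nat : nattrans (Pi S) (h2 S).
Proof.
refine (@NatTrans _ (Pi S) (h2 S) phi _) => w w' m.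
apply: (Pi_ext (f := phi w' \o Pi_act m) (h := afact (h2 S) m \o phi w)) => -[p f e].
have [f' ->] := tpi_surj f.
transitivity (phi w' (Pi_act m (Pi_gen (Closed2 (tpi f') e)))); first by [].
rewrite (Pi_actE _ (pbar_crepr (fleft m)) (pbar_crepr (fright m))) tpi_whisk.
apply: kerval_inj; set n := whisk_bar _ _ _.
rewrite [LHS](val_phi _ _ (m := closed_hom n)) //.
transitivity (afact (FC2 S) m (kerval (phi w (Pi_gen (Closed2 (tpi f') e))))); last by [].
(* Identity 2-cells linearise to zero, so only the middle factor of the whiskering survives. *)
rewrite (val_phi _ _ (m := closed_hom e)) // tsym_act /Twhisk !tsymE add0r addr0.
by apply: tsym_ext; rewrite /= !pcompE pbar_crepr.
Defined.

Definition psi_ker (w : fobjS) : {additive kerab (delta2 S w) -> Pi_ab w} :=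
  psi_lift w \o val.

Lemma psi_kerE (w : fobjS) (a : kerab (delta2 S w)) : psi_ker w a = psi_lift w (kerval a).
Proof. by []. Qed.

(** On a closed [f] the composite yields the loop of [f] in a trivial context, which has the class
    of [f] by [loopcl_closed]. *)
Lemma phiK (w : fobjS) : cancel (phi w) (psi_ker w).
Proof.
move=> q; apply: (Pi_ext (f := psi_ker w \o phi w) (h := idfun)) => -[p f e] {q}.
have [f' ->] := tpi_surj f.
transitivity (psi_ker w (phi w (Pi_gen (Closed2 (tpi f') e)))); first by [].
rewrite psi_kerE (val_phi _ _ (m := closed_hom e)) // psi_lift_tsym.
have pw : pbar (pcat (pnil (fsrc w)) (pcat p (pnil (ftgt w)))) = fcell w.
  by rewrite pcatu0.
rewrite -(@psiE _ _ _ _ _ f' _ (pnil _) (pnil _) pw pw) //.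
rewrite (@loopcl_teq _ _ _ _ _ _ _ e e _ f') ?loopcl_closed //.
exact: TE_trans (TE_H1l _) (TE_H1r _).
Qed.

(** ** The homotopy [htpy] from [FC1] to [FC2] *)

Lemma htpy_subproof (w : fobjS) x y (e : cells1 x y) (m : fhomS (bobj (pone e)) w) :
  @comp (presented S) _ _ _ (comp (fleft m) (pbar (pcons e (crepr (fright m)))))
    (idm (ftgt w)) = fcell w.
Proof. by rewrite compm1 pbar_cons pbar_crepr -(fhomE m) /= pcompA. Qed.

(** The right context of a symbol is absorbed into [nu], leaving an identity on the right;
    additivity in each fibre is all that is claimed. *)
Definition htpy (w : fobjS) : {additive FC1 S w -> FC2 S w} :=
  freelift (fun s : fsymb (@bar1 S) w =>
    tsym (nu (e := projT2 (projT2 (projT1 s))) (a := fright (projT2 s)) erefl)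
      (@FHom _ (bobj (pcons _ (crepr (fright (projT2 s))))) w _ _
         (htpy_subproof (projT2 s)))).

Lemma tsym_nu x y z (e : cells1 x y) (a a' : @pcell S y z) (c c' : pcell x z)
    (ac : pcomp (pbar (pone e)) a = c) (ac' : pcomp (pbar (pone e)) a' = c') (w : fobjS)
    (m : fhomS (bobj (pcons e (crepr a))) w) (m' : fhomS (bobj (pcons e (crepr a'))) w) :
  a = a' -> fleft m = fleft m' -> fright m = fright m' ->
  tsym (nu ac) m = tsym (nu ac') m'.
Proof. by move=> aa'; subst a' c c' => ml mr; apply: tsym_ext. Qed.

Lemma htpy_symb1 (w : fobjS) x y (e : cells1 x y) (m : fhomS (bobj (pone e)) w)
    (a : @pcell S y (ftgt w)) (c : pcell x (ftgt w)) (ac : pcomp (pbar (pone e)) a = c)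
    (n : fhomS (bobj (pcons e (crepr a))) w) :
  fright m = a -> fleft n = fleft m -> fright n = idm (ftgt w) ->
  htpy w (afact (FC1 S) m (symb1 e)) = tsym (nu ac) n.
Proof.
move=> ma nl nr; rewrite [afact _ _ _]freeliftE [LHS]freeliftE.
by apply: tsym_nu => //=; rewrite ?ma ?nl ?nr //= ?pcompE.
Qed.

(** Each generator of [p] contributes one [nu], which is one term of [htpy] of the bracket. The tail
    [u] is kept because [theta] of an empty 1-cell is an arbitrary 2-cell, whose linearisation may
    be nonzero. *)
Lemma tsym_theta x y z (p : path1 x y) (u : path1 y z) x0 (d : @pcell S x0 z)
    c (pc : pbar (pcat p u) = c) b (ub : pbar u = b)
    (m : fhomS (bobj (pcat p u)) (FObjS d)) (n : fhomS (bobj p) (FObjS d))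
    (r : fhomS (bobj u) (FObjS d)) :
  fright m = idm (z : presented S) -> fleft n = fleft m -> fright n = b ->
  fleft r = pcomp (fleft m) (pbar p) -> fright r = idm (z : presented S) ->
  tsym (theta pc) m = htpy _ (afact (FC1 S) n (bracket p)) + tsym (theta ub) r.
Proof.
elim: p u d c pc b ub m n r => [x'|x' y' z' e p IH] u d c pc b ub m n r mr nl nb rl rr.
  rewrite !raddf0 add0r; subst b c.
  by apply: tsym_ext; rewrite ?rl ?mr ?rr ?pcompE.
have pc' : pcomp (pbar (pone e)) (pbar (pcat p u)) = c.
  exact: etrans (esym (pbar_cons _ _)) pc.
pose m1 := fcomp (leftm (pone e) (pcat p u)) m.
pose n1 := fcomp (leftm (pone e) p) n.
rewrite (theta_cons pc erefl pc') tsymV.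
have -> : tsym (TH (TId (pone e)) (theta (erefl (pbar (pcat p u))))) m =
    tsym (theta erefl) m1 by exact: add0r.
have m1r : fright m1 = idm (z : presented S) by rewrite /= mr pcompE.
have n1l : fleft n1 = fleft m1 by rewrite /= nl.
have n1r : fright n1 = b by rewrite /= nb; apply: pcomp1m.
have r1 : fleft r = pcomp (fleft m1) (pbar p) by rewrite /= rl pbar_cons !pcompE.
rewrite (IH u d _ erefl b ub m1 n1 r m1r n1l n1r r1 rr).
rewrite addrAC; congr (_ + _).
rewrite addrC bracket_cons_act raddfD; congr (_ + _).
apply/esym/(@htpy_symb1 (FObjS d) _ _ e _ _ _ pc').
- by rewrite /= nb -ub pbar_cat.
- by rewrite /= nl !pcompE.
- by rewrite /= mr pcompE.
Qed.

(** * The composite of [psi] and [phi] *)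

Lemma phi_psi (w : fobjS) x y (u v : path1 x y) (f : term2 u v)
    (m : fhomS (bobj u) w) (n : fhomS (bobj v) w) :
  fleft m = fleft n -> fright m = fright n ->
  kerval (phi w (psi f m)) =
  tsym f m - (htpy w (afact (FC1 S) m (bracket u)) - htpy w (afact (FC1 S) n (bracket v))).
Proof.
case: w m n => x0 y0 d m n ml mr.
have am := pbar_crepr (fleft m); have bm := pbar_crepr (fright m).
have uv := pbar_term2 f.
rewrite (val_phi _ _ (m := closed_hom (w := FObjS d) (pbar_crepr d))) //.
(* The loop linearises to minus [theta] of the source, plus [f] in context, plus [theta] of the
   target. *)
rewrite /theta_loop /ctx !tsymE add0r addr0.
set a := crepr (fleft m) in am *; set b := crepr (fright m) in bm *.
have mE : pcomp (pcomp (fleft m) (pbar u)) (fright m) = d := fhomE m.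
have aE : @pcomp S _ _ _ (pcomp (pbar (pnil x0)) (pbar a)) (pcomp (pbar u) (fright m)) = d.
  by rewrite pcomp1m am pcompA.
have bE : @pcomp S _ _ _ (pcomp (pcomp (fleft m) (pbar u)) (pbar b)) (pbar (pnil y0)) = d.
  by rewrite pcompm1 bm.
have ubE : @pcomp S _ _ _ (pcomp (fleft m) (pbar (pcat u b))) (pbar (pnil y0)) = d.
  by rewrite pcompm1 pbar_cat bm pcompA.
have vbE : @pcomp S _ _ _ (pcomp (fleft m) (pbar (pcat v b))) (pbar (pnil y0)) = d.
  by rewrite pcompm1 pbar_cat bm pcompA -uv.
pose ma := @FHom (presented S) (bobj a) (FObjS d) _ _ aE.
pose mb := @FHom (presented S) (bobj b) (FObjS d) _ _ bE.
pose mu := @FHom (presented S) (bobj (pcat u b)) (FObjS d) _ _ ubE.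
pose mv := @FHom (presented S) (bobj (pcat v b)) (FObjS d) _ _ vbE.
set cu := ctx_bar _ _ _; set cv := ctx_bar _ _ _.
have ub : pbar (pcat u b) = pcomp (pbar u) (fright m) by rewrite pbar_cat bm.
have vb : pbar (pcat v b) = pcomp (pbar u) (fright m) by rewrite pbar_cat bm -uv.
(* Peel [a] off both [theta] terms, then [u] and [v]. The terms for [a] and the [theta] of [b] are
   common to both sides and cancel at the end. *)
rewrite (tsym_theta cu ub (n := ma) (r := mu)) ?(tsym_theta cv vb (n := ma) (r := mv));
  [ | by rewrite /= ?pcompE ?am .. ].
rewrite (tsym_theta ub bm (n := m) (r := mb)) ?(tsym_theta vb bm (n := n) (r := mb));
  [ | by rewrite /= ?uv ?ml ?mr ?pcompE .. ].
rewrite addrCA; congr (_ + _).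
  by apply: tsym_ext; rewrite /= ?pcompE ?am ?bm.
by rewrite opprD addrACA addNr add0r opprD addrACA addNr addr0 opprB addrC.
Qed.

(** Both sides are additive, so generators suffice; there [phi_psi] leaves a difference of brackets,
    which [delta2_tsym] identifies with [delta2]. *)
Lemma phi_psi_lift (w : fobjS) (x : FC2 S w) :
  kerval (phi w (psi_lift w x)) = x - htpy w (delta2 S w x).
Proof.
apply: (freeab_ext (f := val \o phi w \o psi_lift w)
  (h := idfun \- (htpy w \o delta2 S w))) => -[i m].
transitivity (kerval (phi w (psi_lift w (tsym (TGen (cell2 i)) m)))).
  by case: i m.
have ml : fleft m = fleft (fcomp (coerm (bar_tgt i)) m) by rewrite /= pcompE.
have mr : fright m = fright (fcomp (coerm (bar_tgt i)) m) by rewrite /= pcompE.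
rewrite psi_lift_tsym (phi_psi _ ml mr) -raddfB -(delta2_tsym (TGen (cell2 i)) ml mr).
by case: i m {ml mr}.
Qed.

Lemma psi_kerK (w : fobjS) : cancel (psi_ker w) (phi w).
Proof.
move=> a; apply: kerval_inj; rewrite psi_kerE phi_psi_lift.
by case: a => a /=; rewrite unfold_in => /eqP ->; rewrite raddf0 subr0.
Qed.

End Syzygies.

Theorem theorem5p6p5 (S : polygraph2) : natiso (h2 S) (Pi S).
Proof. exact: (@natiso_inv _ _ _ (phi_nat S) (@psi_ker S) (@phiK S) (@psi_kerK S)). Qed.
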